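(* Let $T$ be an in-star (a centre vertex $c$ with arcs $\ell_i\to c$ from its leaves) carrying a \textsc{blocking pebbles} position with only blue and red pebbles. Let $b_c\ge0$ be the number of blue pebbles on $c$, $b_\ell\ge 0$ the total number of blue pebbles on the leaves, and define $r_c,r_\ell$ similarly for red. Then: (1) if some leaves carry at least one blue pebble in total, the centre carries at least one blue pebble, and there are no red pebbles anywhere, the game value of $T$ is $3b_c+2b_\ell-2$. For the in-star with exactly two leaves $\ell_1,\ell_2$, write $[(x,y),[p,q],[s,t]]$ for the position with $x$ blue and $y$ red pebbles on $c$, $p$ blue and $q$ red on $\ell_1$, and $s$ blue and $t$ red on $\ell_2$. Then: (2) $[(0,0),[0,1],[1,0]]$ has value $0$ and $[(0,0),[0,2],[2,0]]$ has value $*$; (3) for $a\ge 2$, $[(0,0),[a,0],[0,1]]$ has value $2a-2$; (4) for $a\ge 3$, $[(0,0),[a,0],[0,2]]$ has value $\{2a-6\mid 0\}$; (5) for $a,b\ge 3$, $[(0,0),[a,0],[0,b]]$ has value $\{2a-6\mid -2b+6\}$; (6) for $a,b\ge 1$ and $c\ge 2$, $[(a,0),[b,0],[0,c]]$ has value $3a+2b-5$.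
   Context: \textsc{Blocking pebbles}: a position is a finite directed acyclic graph with, at each vertex, numbers of blue, red and green pebbles (here no green pebbles). An in-neighbour of $v$ is $u$ with an arc $u\to v$; an out-neighbour is $w$ with an arc $v\to w$. Left, from a chosen vertex $v$, either (1) moves a positive number of her pebbles (blue or green) from $v$ to a single in-neighbour of $v$ at no cost, or (2) removes two of her pebbles from $v$ and places one pebble on an out-neighbour of $v$. No blue pebble may be moved onto a vertex currently carrying a red pebble. Right has the symmetric moves with red (and green) pebbles, and no red pebble may be moved onto a vertex carrying a blue pebble. Normal play (last player to move wins). Values are combinatorial game values in Conway's sense; $*=\{0\mid0\}$. *)

(* Defs.v *)
From HB Require Import structures.
From mathcomp Require Import all_boot all_order all_algebra.
From mathcomp Require Import zify.

Set Implicit Arguments.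
Unset Strict Implicit.
Unset Printing Implicit Defensive.

(** * Partizan games *)

Inductive game : Type :=
  Game (LI RI : Type) (GL : LI -> game) (GR : RI -> game).

Definition lindex (G : game) : Type := let: Game LI _ _ _ := G in LI.
Definition rindex (G : game) : Type := let: Game _ RI _ _ := G in RI.
Definition lopt (G : game) : lindex G -> game :=
  let: Game _ _ GL _ := G in GL.
Definition ropt (G : game) : rindex G -> game :=
  let: Game _ _ _ GR := G in GR.

(* Conway's order: G <= H iff H <= G^L for no left option G^L of G and
   H^R <= G for no right option H^R of H.  The arguments are exchanged in the
   recursive calls, so [game_cmp G H] computes the pair (G <= H, H <= G);
   [game_leE] recovers Conway's clause. *)
Fixpoint game_cmp (G : game) : game -> Prop * Prop :=
  match G with
  | Game _ _ GL GR =>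
    fix game_cmpG (H : game) : Prop * Prop :=
      match H with
      | Game _ _ HL HR =>
        ((forall i, ~ (game_cmp (GL i) H).2) /\
           (forall j, ~ (game_cmpG (HR j)).2),
         (forall i, ~ (game_cmpG (HL i)).1) /\
           (forall j, ~ (game_cmp (GR j) H).1))
      end
  end.

Definition game_le (G H : game) : Prop := (game_cmp G H).1.

Definition game_eq (G H : game) : Prop := game_le G H /\ game_le H G.

Lemma game_cmpC (G H : game) :
  ((game_cmp G H).1 <-> (game_cmp H G).2) /\
  ((game_cmp G H).2 <-> (game_cmp H G).1).
Proof.
elim: G H => [LI RI GL IHL GR IHR] H.
elim: H => [LI' RI' HL JHL HR JHR] /=.
split; split=> -[A B]; split=> i C.
- by apply: (A i); apply/(IHL i (Game HL HR)).2.
- by apply: (B i); apply/(JHR i).2.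
- by apply: (A i); apply/(IHL i (Game HL HR)).2.
- by apply: (B i); apply/(JHR i).2.
- by apply: (A i); apply/(JHL i).1.
- by apply: (B i); apply/(IHR i (Game HL HR)).1.
- by apply: (A i); apply/(JHL i).1.
- by apply: (B i); apply/(IHR i (Game HL HR)).1.
Qed.

Lemma game_leE (G H : game) :
  game_le G H <->
  (forall i : lindex G, ~ game_le H (lopt i)) /\
  (forall j : rindex H, ~ game_le (ropt j) G).
Proof.
case: G H => [LI RI GL GR] [LI' RI' HL HR]; rewrite /game_le.
split=> -[A B]; split=> i C.
- by apply: (A i); apply/(game_cmpC (GL i) (Game HL HR)).2.
- by apply: (B i); apply/(game_cmpC (Game GL GR) (HR i)).2.
- by apply: (A i); apply/(game_cmpC (GL i) (Game HL HR)).2.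
- by apply: (B i); apply/(game_cmpC (Game GL GR) (HR i)).2.
Qed.

Definition game0 : game := Game (of_void game) (of_void game).

(* {G | H} *)
Definition game_switch (G H : game) : game :=
  Game (fun _ : unit => G) (fun _ : unit => H).

Definition game_star : game := game_switch game0 game0.

Fixpoint game_opp (G : game) : game :=
  let: Game _ _ GL GR := G in
  Game (fun j => game_opp (GR j)) (fun i => game_opp (GL i)).

(* 0 = { | } and n + 1 = {n | } *)
Fixpoint game_nat (n : nat) : game :=
  if n is m.+1 then Game (fun _ : unit => game_nat m) (of_void game)
  else game0.

Definition game_int (z : int) : game :=
  match z with
  | Posz n => game_nat n
  | Negz n => game_opp (game_nat n.+1)
  end.

(** * Blocking pebbles *)

Record dag : Type := Dag {
  vertex :> finType;
  arc : rel vertex;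
  dag_acyclic : forall (v : vertex) (s : seq vertex),
    path arc v s -> last v s = v -> s = [::]
}.

Record position (D : dag) : Type := Position {
  blue : {ffun D -> nat};
  red : {ffun D -> nat}
}.

(* [pebble_move own opp own'] : a player whose pebbles are distributed as [own],
   against an opponent's [opp], can reach [own'] in one move. *)
Variant pebble_move (D : dag) (own opp : {ffun D -> nat}) :
    {ffun D -> nat} -> Prop :=
  | MoveIn (v u : D) (k : nat) of
      arc u v & 0 < k <= own v & opp u = 0 :
    pebble_move own opp
      [ffun x => if x == v then own v - k
                 else if x == u then own u + k else own x]
  | MoveOut (v w : D) of
      arc v w & 2 <= own v & opp w = 0 :
    pebble_move own opp
      [ffun x => if x == v then own v - 2
                 else if x == w then own w + 1 else own x].

Definition left_move (D : dag) (p q : position D) : Prop :=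
  pebble_move (blue p) (red p) (blue q) /\ red q = red p.

Definition right_move (D : dag) (p q : position D) : Prop :=
  pebble_move (red p) (blue p) (red q) /\ blue q = blue p.

Definition is_option (D : dag) (q p : position D) : Prop :=
  left_move p q \/ right_move p q.

Definition rank (D : dag) (v : D) : nat := #|[pred u | connect (@arc D) u v]|.

(* Termination measure: every move strictly decreases the mover's weight. *)
Definition weight (D : dag) (f : {ffun D -> nat}) : nat :=
  \sum_v f v * (#|D| + rank v).

Lemma arc_irrefl (D : dag) (v : D) : arc v v = false.
Proof.
apply/negP => a; have := @dag_acyclic D v [:: v].
by rewrite /= a => /(_ isT erefl).
Qed.

Lemma rank_arc (D : dag) (u v : D) : arc u v -> rank u < rank v.
Proof.
move=> a; apply: proper_card; apply/properP; split.
  by apply/subsetP => x; rewrite !inE => /connect_trans; apply; apply: connect1.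
exists v; rewrite !inE ?connect0 //; apply/negP => /connectP [s vs us].
have := @dag_acyclic D v (rcons s v).
by rewrite rcons_path vs -us a last_rcons => /(_ isT erefl); case: (s).
Qed.

Lemma weight_move (D : dag) (f g h : {ffun D -> nat}) :
  pebble_move f g h -> weight h < weight f.
Proof.
have split2 (a b : D) (F : D -> nat) : b != a ->
    \sum_v F v = F a + (F b + \sum_(v | (v != a) && (v != b)) F v).
  by move=> ab; rewrite (bigD1 a) //= (bigD1 b).
case=> [v u k a /andP [k0 kv] _|v w a fv _]; rewrite /weight.
- have uv : u != v by apply: contraTneq a => ->; rewrite arc_irrefl.
  rewrite !(split2 _ _ _ uv) !ffunE !eqxx (negPf uv).
  rewrite (eq_bigr (fun x => f x * (#|D| + rank x))); last first.
    by move=> x /andP [/negPf xv /negPf xu]; rewrite ffunE xv xu.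
  have := rank_arc a; rewrite -(subnKC kv) addKn.
  move: (_ - _) (rank u) (rank v) #|D| (f u) (\sum_(_ | _) _) => m ru rv N fu S ruv.
  have : k * (N + ru) < k * (N + rv) by rewrite ltn_pmul2l // ltn_add2l.
  rewrite !mulnDl; lia.
- have wv : w != v by apply: contraTneq a => ->; rewrite arc_irrefl.
  rewrite !(split2 _ _ _ wv) !ffunE !eqxx (negPf wv).
  rewrite (eq_bigr (fun x => f x * (#|D| + rank x))); last first.
    by move=> x /andP [/negPf xv /negPf xw]; rewrite ffunE xv xw.
  have := rank_arc a; have : rank w <= #|D| by apply: max_card.
  have : 0 < rank v by apply/card_gt0P; exists v; rewrite inE connect0.
  rewrite -(subnKC fv) addKn.
  move: (_ - _) (rank v) (rank w) #|D| (f w) (\sum_(_ | _) _) => m rv rw N fw S rv0 rwN rvw.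
  rewrite !mulnDl; lia.
Qed.

Lemma is_option_wf (D : dag) : well_founded (@is_option D).
Proof.
move=> p; have [n] := ubnP (weight (blue p) + weight (red p)).
elim: n p => [p|n IHn p]; first by rewrite ltn0.
rewrite ltnS => pn.
constructor=> q [] [/weight_move m e];
  apply: IHn; apply: leq_trans pn; rewrite e.
- by rewrite ltn_add2r.
- by rewrite ltn_add2l.
Qed.

Fixpoint game_of_acc (D : dag) (p : position D) (a : Acc (@is_option D) p)
    {struct a} : game :=
  Game
    (fun q : {q | left_move p q} =>
       game_of_acc (Acc_inv a (or_introl (proj2_sig q))))
    (fun q : {q | right_move p q} =>
       game_of_acc (Acc_inv a (or_intror (proj2_sig q)))).

Definition game_of (D : dag) (p : position D) : game :=
  game_of_acc (is_option_wf p).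

Definition has_value (D : dag) (p : position D) (G : game) : Prop :=
  game_eq (game_of p) G.

(** * In-stars *)

Definition in_star (D : dag) (c : D) : Prop :=
  forall u v : D, arc u v = (u != c) && (v == c).

Definition leaf_total (D : dag) (c : D) (f : {ffun D -> nat}) : nat :=
  \sum_(v : D | v != c) f v.

Definition in_star2 (D : dag) (c l1 l2 : D) : Prop :=
  [/\ in_star c, l1 != l2 & [set~ c] = [set l1; l2]].

(* The position [(x, y), [p, q], [s, t]]; each pair is (blue, red). *)
Definition star2_pos (D : dag) (c l1 l2 : D) (xy pq st : nat * nat) :
    position D :=
  let pebbles (v : D) : nat * nat :=
    if v == c then xy else if v == l1 then pq else st in
  Position [ffun v => (pebbles v).1] [ffun v => (pebbles v).2].

(* Main.v *)
(** On an in-star each Left move lowers the potential [3 b_c + 2 b_l] by at least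
    one, whatever Right does; when Right has no move, Left can lower it by exactly
    one at a time down to [2], the potential of a single pebble on a leaf.

    With two leaves held by opposite colours, a player standing on the centre
    blocks the opponent completely.  Left on the centre therefore plays alone, but
    must not vacate the centre: Right would occupy it at once and leave Left
    without a move.  This costs her three of the [3 x + 2 p - 2] moves, so the value
    is [3 x + 2 p - 5].  When the centre is empty each player has a single move,
    occupying it, which gives the switches. *)

Require Import Defs.
From mathcomp Require Import all_boot all_order all_algebra.
From mathcomp Require Import zify.

Set Implicit Arguments.
Unset Strict Implicit.
Unset Printing Implicit Defensive.

(** * Order, negation and integers for abstract games *)

Lemma game_le_refl (G : game) : game_le G G.
Proof.
elim: G => LI RI GL IHL GR IHR; apply/game_leE; split=> i /game_leE [A B].
- exact: (A i (IHL i)).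
- exact: (B i (IHR i)).
Qed.

(** Unfolding Conway's clause replaces one game by an option and rotates the three games cyclically,
    so the three rotations of [T G H K] are proved by one simultaneous induction. *)
Lemma game_le_trans (H G K : game) : game_le G H -> game_le H K -> game_le G K.
Proof.
pose T G H K := game_le G H -> game_le H K -> game_le G K.
have step A B C : (forall i, T B C (lopt (G := A) i)) ->
    (forall j, T (ropt (G := C) j) A B) -> T A B C.
  move=> TL TR AB BC; have /game_leE [AL _] := AB.
  have /game_leE [_ CR] := BC; apply/game_leE; split=> i le.
  - exact: AL i (TL i BC le).
  - exact: CR i (TR i le AB).
suff: [/\ T G H K, T H K G & T K G H] by case.
elim: G H K => LI RI GL IHGL GR IHGR H.
elim: H => LI' RI' HL IHHL HR IHHR.
elim=> LI'' RI'' KL IHKL KR IHKR.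
split; apply: step => /= i.
- by case: (IHGL i (Game HL HR) (Game KL KR)).
- by case: (IHKR i).
- by case: (IHHL i (Game KL KR)).
- by case: (IHGR i (Game HL HR) (Game KL KR)).
- by case: (IHKL i).
- by case: (IHHR i (Game KL KR)).
Qed.

Lemma game_eq_sym (G H : game) : game_eq G H -> game_eq H G.
Proof. by case. Qed.

Lemma game_eq_trans (H G K : game) : game_eq G H -> game_eq H K -> game_eq G K.
Proof. by move=> [a b] [a' b']; split; apply: game_le_trans; eassumption. Qed.

(** Otherwise transitivity would put [H] below one of its own left options, or a right option of [G]
    below [G], which Conway's clause forbids. *)
Lemma game_le_opts (G H : game) :
  (forall i : lindex G, exists j : lindex H, game_le (lopt i) (lopt j)) ->
  (forall j : rindex H, exists i : rindex G, game_le (ropt i) (ropt j)) ->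
  game_le G H.
Proof.
move=> L R; apply/game_leE; split=> [i|j] le.
- have [j ij] := L i; have /game_leE [A _] := game_le_trans le ij.
  exact: A j (game_le_refl _).
- have [i ij] := R j; have /game_leE [_ A] := game_le_trans ij le.
  exact: A i (game_le_refl _).
Qed.

Lemma game_le_opp (G H : game) :
  game_le (game_opp H) (game_opp G) <-> game_le G H.
Proof.
(* Conway's clause exchanges its arguments, so both inequalities go through the induction
   together. *)
suff: (game_le (game_opp H) (game_opp G) <-> game_le G H) /\
      (game_le (game_opp G) (game_opp H) <-> game_le H G) by case.
elim: G H => LI RI GL IHL GR IHR; elim=> LI' RI' HL JHL HR JHR.
split; split=> /game_leE [/= A B]; apply/game_leE; split=> /= i.
- by move/(IHL i (Game HL HR)).2; apply: B.
- by move/(JHR i).2; apply: A.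
- by move/(JHR i).2; apply: B.
- by move/(IHL i (Game HL HR)).2; apply: A.
- by move/(JHL i).1; apply: B.
- by move/(IHR i (Game HL HR)).1; apply: A.
- by move/(IHR i (Game HL HR)).1; apply: B.
- by move/(JHL i).1; apply: A.
Qed.

Lemma game_eq_opp (G H : game) :
  game_eq G H -> game_eq (game_opp G) (game_opp H).
Proof. by case=> a b; split; apply/game_le_opp. Qed.

Lemma game_le_nat (m n : nat) : game_le (game_nat m) (game_nat n) <-> m <= n.
Proof.
have [s] := ubnP (m + n); elim: s m n => // s IH m n mns.
split=> [le|mn].
- case: m mns le => // m mns /game_leE [/(_ tt) /= A _].
  by rewrite ltnNge; apply/negP => nm; apply/A/IH => //; lia.
- apply/game_leE; split; last by case: (n) => [|k] [].
  case: m mns mn => [|m] mns mn; first by case.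
  by move=> _ /IH H; have := H ltac:(lia); rewrite leqNgt mn.
Qed.

Lemma game_int_oppnat (n : nat) :
  game_eq (game_int (- n%:Z)%R) (game_opp (game_nat n)).
Proof.
(* At [n = 0] the right side is a negated zero, equal to [game0] in value but not as a term; for
   positive [n] both sides coincide by computation. *)
by case: n => [|n]; split; try exact: game_le_refl;
  apply/game_leE; split; case.
Qed.

Lemma game_le_nat_of (G : game) (n : nat) :
  (forall i : lindex G, exists2 m, m < n & game_le (lopt i) (game_nat m)) ->
  game_le G (game_nat n).
Proof.
move=> L; apply/game_leE; split; last by case: (n) => [|k] [].
move=> i le; have [m mn lm] := L i.
by have /game_le_nat := game_le_trans le lm; rewrite leqNgt mn.
Qed.

Lemma game_nat_le_of (G : game) (n : nat) :
  (rindex G -> False) ->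
  (0 < n -> exists i : lindex G, game_le (game_nat n.-1) (lopt i)) ->
  game_le (game_nat n) G.
Proof.
move=> R L; apply/game_leE; split=> [|/R //].
case: n L => [_ []|n /(_ isT) [i le] u /game_leE [A _]].
exact: A i le.
Qed.

Lemma game_eq_switch (G X Y : game) :
  (forall i : lindex G, game_eq (lopt i) X) ->
  (forall j : rindex G, game_eq (ropt j) Y) ->
  lindex G -> rindex G -> game_eq G (game_switch X Y).
Proof.
move=> L R i0 j0; split; apply: game_le_opts => [i|j].
- by exists tt; case: (L i).
- by exists j0; case: (R j0).
- by exists i0; case: (L i0).
- by exists tt; case: (R j).
Qed.

(** * Positions as games: options correspond to moves, up to equality of values *)

Lemma game_of_acc_irrelevance (D : dag) (p : position D)
    (a b : Acc (@is_option D) p) :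
  game_eq (game_of_acc a) (game_of_acc b).
Proof.
(* Both games index their options by the same moves; only the accessibility proofs attached to [q]
   differ, and the induction hypothesis absorbs that. *)
elim/Acc_inv_dep: a b => {}p f IH [g].
split; apply: game_le_opts => -[q m] /=; exists (exist _ q m) => /=.
- by case: (IH q (or_introl m) (g q (or_introl m))).
- by case: (IH q (or_intror m) (g q (or_intror m))).
- by case: (IH q (or_introl m) (g q (or_introl m))).
- by case: (IH q (or_intror m) (g q (or_intror m))).
Qed.

Lemma left_move_lopt (D : dag) (p q : position D) :
  left_move p q ->
  exists i : lindex (game_of p), game_eq (lopt i) (game_of q).
Proof.
rewrite /game_of => m; case: (is_option_wf p) => f.
by exists (exist _ q m); apply: game_of_acc_irrelevance.
Qed.

Lemma right_move_ropt (D : dag) (p q : position D) :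
  right_move p q ->
  exists j : rindex (game_of p), game_eq (ropt j) (game_of q).
Proof.
rewrite /game_of => m; case: (is_option_wf p) => f.
by exists (exist _ q m); apply: game_of_acc_irrelevance.
Qed.

Lemma lopt_left_move (D : dag) (p : position D) (i : lindex (game_of p)) :
  exists2 q, left_move p q & game_eq (lopt i) (game_of q).
Proof.
move: i; rewrite /game_of; case: (is_option_wf p) => f [q m].
by exists q => //; apply: game_of_acc_irrelevance.
Qed.

Lemma ropt_right_move (D : dag) (p : position D) (j : rindex (game_of p)) :
  exists2 q, right_move p q & game_eq (ropt j) (game_of q).
Proof.
move: j; rewrite /game_of; case: (is_option_wf p) => f [q m].
by exists q => //; apply: game_of_acc_irrelevance.
Qed.

Lemma game_of_le_nat (D : dag) (p : position D) (n : nat) :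
  (forall q, left_move p q ->
     exists2 m, m < n & game_le (game_of q) (game_nat m)) ->
  game_le (game_of p) (game_nat n).
Proof.
move=> L; apply: game_le_nat_of => i.
have [q /L [m mn qm] [iq _]] := lopt_left_move i.
by exists m => //; apply: game_le_trans qm.
Qed.

Lemma game_nat_le_of_pos (D : dag) (p : position D) (n : nat) :
  (forall q, ~ right_move p q) ->
  (0 < n -> exists2 q, left_move p q & game_le (game_nat n.-1) (game_of q)) ->
  game_le (game_nat n) (game_of p).
Proof.
move=> R L; apply: game_nat_le_of => [j|/L [q /left_move_lopt [i [_ qi]] nq]].
  by have [q /R] := ropt_right_move j.
by exists i; apply: game_le_trans qi.
Qed.

Lemma has_value_switch (D : dag) (p q r : position D) (X Y : game) :
  left_move p q -> (forall q', left_move p q' -> q' = q) -> has_value q X ->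
  right_move p r -> (forall r', right_move p r' -> r' = r) -> has_value r Y ->
  has_value p (game_switch X Y).
Proof.
move=> pq uq qX pr ur rY.
have [i _] := left_move_lopt pq; have [j _] := right_move_ropt pr.
apply: game_eq_switch => // [i'|j'].
- by have [q' /uq -> e] := lopt_left_move i'; apply: game_eq_trans qX.
- by have [r' /ur -> e] := ropt_right_move j'; apply: game_eq_trans rY.
Qed.

(** * Exchanging the colours negates the game *)

Definition swap_colors (D : dag) (p : position D) : position D :=
  Position (red p) (blue p).

(** A [left_move] between two positions and the [right_move] between their swaps unfold to the same
    proposition, so [m] serves unchanged on the other side. *)
Lemma game_of_acc_swap (D : dag) (p : position D) (a : Acc (@is_option D) p)
    (b : Acc (@is_option D) (swap_colors p)) :
  game_eq (game_of_acc b) (game_opp (game_of_acc a)).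
Proof.
elim/Acc_inv_dep: a b => {}p f IH [g].
split; apply: game_le_opts => -[[bl re] m] /=;
  exists (exist _ (Position re bl) m) => /=.
- by case: (IH (Position re bl) (or_intror m) (g _ (or_introl m))).
- by case: (IH _ (or_introl m) (g (Position re bl) (or_intror m))).
- by case: (IH _ (or_intror m) (g (Position re bl) (or_introl m))).
- by case: (IH (Position re bl) (or_introl m) (g _ (or_intror m))).
Qed.

Lemma has_value_swap (D : dag) (p : position D) (X : game) :
  has_value (swap_colors p) X -> has_value p (game_opp X).
Proof.
move=> pX; have := game_of_acc_swap (is_option_wf (swap_colors p))
  (is_option_wf (swap_colors (swap_colors p))).
have -> : swap_colors (swap_colors p) = p by case: (p).
by move=> e; apply: game_eq_trans e (game_eq_opp pX).
Qed.

(** * The potential on in-stars *)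

Lemma leaf_total_in (D : dag) (c u : D) (f : {ffun D -> nat}) (k : nat) :
  u != c ->
  leaf_total c [ffun x => if x == c then f c - k
                          else if x == u then f u + k else f x] =
  leaf_total c f + k.
Proof.
move=> uc; rewrite /leaf_total !(bigD1 u uc) /= ffunE eqxx (negPf uc).
rewrite [RHS]addnAC; congr (_ + _); apply: eq_bigr => x /andP [xc xu].
by rewrite ffunE (negPf xc) (negPf xu).
Qed.

Lemma leaf_total_out (D : dag) (c v : D) (f : {ffun D -> nat}) :
  v != c -> 2 <= f v ->
  leaf_total c f =
  (leaf_total c [ffun x => if x == v then f v - 2
                           else if x == c then f c + 1 else f x]).+2.
Proof.
move=> vc fv; rewrite /leaf_total !(bigD1 v vc) /= ffunE eqxx.
rewrite -2!addSn -addn2 subnK //; congr (_ + _).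
by apply: eq_bigr => x /andP [xc xv]; rewrite ffunE (negPf xc) (negPf xv).
Qed.

(** Feeding [k] pebbles from the centre to a leaf turns [3 * k] into [2 * k]; merging two leaf
    pebbles turns 4 into 3. Either move needs a centre pebble or two on a leaf, hence a potential
    above 2. *)
Lemma star_moveP (D : dag) (c : D) (own opp own' : {ffun D -> nat}) :
  in_star c -> pebble_move own opp own' ->
  3 * own' c + 2 * leaf_total c own' < 3 * own c + 2 * leaf_total c own
  /\ 2 < 3 * own c + 2 * leaf_total c own.
Proof.
move=> S; case=> [v u k|v w]; rewrite S => /andP [nc /eqP e].
- rewrite {}e => /andP [k0 kc] _; rewrite leaf_total_in // ffunE eqxx; lia.
- rewrite {}e => fv _; rewrite (leaf_total_out nc fv) ffunE eqxx.
  by rewrite eq_sym (negPf nc); lia.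
Qed.

Lemma star_le (D : dag) (c : D) (p : position D) :
  in_star c ->
  game_le (game_of p) (game_nat (3 * blue p c + 2 * leaf_total c (blue p) - 2)).
Proof.
move=> S; have [s] := ubnP (3 * blue p c + 2 * leaf_total c (blue p)).
elim: s p => // s IH p ps; apply: game_of_le_nat => q [/(star_moveP S) m _].
(* Truncation does no harm: the potential before the move exceeds 2, so the bound drops strictly. *)
exists (3 * blue q c + 2 * leaf_total c (blue q) - 2); first by lia.
by apply: IH; lia.
Qed.

Lemma star_no_right_move (D : dag) (c : D) (p q : position D) :
  in_star c -> red p c = 0 -> (forall v, v != c -> red p v <= 1) ->
  ~ right_move p q.
Proof.
move=> S rc rl [m _]; case: m => [v u k|v w]; rewrite S => /andP [nc /eqP e].
- by rewrite e rc; case: k.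
- by rewrite ltnNge rl.
Qed.

(* Left loses exactly one unit of potential per move by merging two pebbles of a
   leaf whenever she can, and otherwise feeding an occupied leaf from the centre;
   she gets stuck only with a single pebble left. *)
Lemma star_ge (D : dag) (c l : D) (p : position D) :
  in_star c -> red p c = 0 -> (forall v, v != c -> red p v <= 1) ->
  (forall v, v != c -> 0 < blue p v -> red p v = 0) ->
  l != c -> red p l = 0 ->
  [\/ 0 < blue p c, exists2 v, v != c & 2 <= blue p v
    | leaf_total c (blue p) <= 1] ->
  game_le (game_nat (3 * blue p c + 2 * leaf_total c (blue p) - 2)) (game_of p).
Proof.
move=> S rc rl; have [s] := ubnP (3 * blue p c + 2 * leaf_total c (blue p)).
elim: s p rc rl => // s IH p rc rl ps free lc rl0 good.
apply: game_nat_le_of_pos => [q|n0]; first exact: star_no_right_move.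
have [/existsP [v /andP [vc bv]]|none] :=
    boolP [exists v : D, (v != c) && (2 <= blue p v)].
- pose f := [ffun x => if x == v then blue p v - 2
                       else if x == c then blue p c + 1 else blue p x].
  have e := leaf_total_out vc bv; rewrite -/f in e.
  have fc : f c = (blue p c).+1 by rewrite ffunE eq_sym (negPf vc) eqxx addn1.
  exists (Position f (red p)).
    by split=> //; apply: MoveOut; rewrite // S vc eqxx.
  have := IH (Position f (red p)); rewrite /= fc e.
  have -> : (3 * blue p c + 2 * (leaf_total c f).+2 - 2).-1 =
            3 * (blue p c).+1 + 2 * leaf_total c f - 2 by lia.
  apply=> //; [lia| |by constructor].
  move=> x xc; rewrite ffunE; case: eqP => [-> _|_].
    by apply: free => //; apply: leq_trans bv.
  by rewrite (negPf xc); apply: free.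
have small v : v != c -> blue p v <= 1.
  move=> vc; rewrite leqNgt; apply/negP => bv; case/negP: none.
  by apply/existsP; exists v; rewrite vc.
(* With the centre empty and at most one leaf pebble the potential would be at most 2, against
   [n0]. *)
have bc : 0 < blue p c.
  by case: good => // [[v vc]|]; [rewrite ltnNge small|lia].
(* An occupied leaf is preferred, since one more pebble makes it mergeable; if all leaves are
   blue-free, [l] receives the only leaf pebble. *)
have [u [uc ru gu]] : exists u, [/\ u != c, red p u = 0
    & 0 < blue p u \/ leaf_total c (blue p) = 0].
  have [/existsP [v /andP [vc bv]]|no] :=
      boolP [exists v : D, (v != c) && (0 < blue p v)].
    by exists v; split=> //; [apply: free|left].
  exists l; split=> //; right; apply: big1 => v vc; apply/eqP.
  rewrite -leqn0 leqNgt; apply/negP => bv; case/negP: no.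
  by apply/existsP; exists v; rewrite vc.
pose f := [ffun x => if x == c then blue p c - 1
                     else if x == u then blue p u + 1 else blue p x].
have e := leaf_total_in (blue p) 1 uc; rewrite -/f in e.
have fc : f c = blue p c - 1 by rewrite ffunE eqxx.
exists (Position f (red p)).
  by split=> //; apply: MoveIn; rewrite // S uc eqxx.
have := IH (Position f (red p)); rewrite /= fc e.
have -> : (3 * blue p c + 2 * leaf_total c (blue p) - 2).-1 =
          3 * (blue p c - 1) + 2 * (leaf_total c (blue p) + 1) - 2 by lia.
apply=> //; [lia| |].
- move=> x xc; rewrite ffunE (negPf xc); case: eqP => [-> //|_].
  exact: free.
- case: gu => [bu|->]; last by constructor 3.
  by constructor 2; exists u => //; rewrite ffunE eqxx (negPf uc) addn1.
Qed.

(** * Two leaves held by opposite colours *)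

Definition facing (D : dag) (c l1 l2 : D) (x y p t : nat) : position D :=
  star2_pos c l1 l2 (x, y) (p, 0) (0, t).

Lemma in_star2C (D : dag) (c l1 l2 : D) : in_star2 c l1 l2 -> in_star2 c l2 l1.
Proof. by case=> S ll e; split; rewrite // 1?eq_sym // setUC. Qed.

Lemma in_star2P (D : dag) (c l1 l2 : D) : in_star2 c l1 l2 ->
  [/\ l1 != c, l2 != c & forall v, v != c -> v = l1 \/ v = l2].
Proof.
case=> _ _ /setP e; split.
- by have := e l1; rewrite !inE eqxx.
- by have := e l2; rewrite !inE eqxx orbT.
- move=> v vc; have := e v; rewrite !inE vc => /esym/orP.
  by case=> /eqP; [left|right].
Qed.

Lemma star2_posC (D : dag) (c l1 l2 : D) xy pq st : in_star2 c l1 l2 ->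
  star2_pos c l1 l2 xy pq st = star2_pos c l2 l1 xy st pq.
Proof.
move=> S; have [l1c l2c lP] := in_star2P S; have [_ ll _] := S.
have e (v : D) :
    (if v == c then xy else if v == l1 then pq else st) =
    (if v == c then xy else if v == l2 then st else pq).
  case: eqVneq => // /lP [] ->; rewrite eqxx ?(negPf ll) //.
  by rewrite eq_sym (negPf ll).
by rewrite /star2_pos; congr Position; apply/ffunP => v; rewrite !ffunE e.
Qed.

(** With the leaves exchanged along with the colours, statements about Right reduce to those about
    Left. *)
Lemma swap_facing (D : dag) (c l1 l2 : D) x y p t : in_star2 c l1 l2 ->
  swap_colors (facing c l1 l2 x y p t) = facing c l2 l1 y x t p.
Proof.
move=> S; rewrite /facing star2_posC // /swap_colors /star2_pos /=.
congr Position; apply/ffunP => v; rewrite !ffunE;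
by case: ifP => // _; case: ifP.
Qed.

(* The blue pebbles stay on {c, l1} and the red ones on {c, l2}: a colour
   vacates its leaf only by standing on the centre, which blocks the other. *)
Lemma left_facingP (D : dag) (c l1 l2 : D) x y p t q : in_star2 c l1 l2 ->
  left_move (facing c l1 l2 x y p t) q -> (x == 0) || (0 < t) ->
  (exists2 k, 0 < k <= x & q = facing c l1 l2 (x - k) y (p + k) t) \/
  [/\ y = 0, 2 <= p & q = facing c l1 l2 x.+1 0 (p - 2) t].
Proof.
move=> S [m e] xt; move: e; have [l1c l2c lP] := in_star2P S; have [St ll _] := S.
case: q m => bq rq /= m ->; rewrite /facing /star2_pos /=.
have l21 : l2 == l1 = false by rewrite eq_sym (negPf ll).
inversion m as [v u k a kv ou E|v w a ov ow E].
- move: a kv ou; rewrite St => /andP [uc /eqP vc]; rewrite vc !ffunE eqxx /=.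
  rewrite (negPf uc) => kx ou; left; exists k => //.
  (* The leaf [l2] is open to blue only if [t = 0], and then [xt] leaves no blue pebble on the
     centre to feed it. *)
  have u1 : u = l1.
    have [//|u2] := lP _ uc; move: ou; rewrite u2 l21 /= => t0.
    by move: kx xt; rewrite t0; lia.
  congr Position; apply/ffunP => z; rewrite !ffunE ?u1 ?eqxx /=;
  by case: (eqVneq z c) => //= zc; case: (eqVneq z l1).
- move: a ov ow; rewrite St => /andP [vc /eqP wc]; rewrite wc !ffunE eqxx /=.
  have [v1|v2] := lP _ vc; last by rewrite v2 l21 (negPf l2c).
  rewrite v1 (negPf l1c) eqxx /= => p2 y0; right; split=> //; rewrite ?y0 //.
  congr Position; apply/ffunP => z; rewrite !ffunE ?eqxx ?(negPf l1c) /=;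
  case: (eqVneq z c) => [zc|zc] //=; try by case: (eqVneq z l1).
  by rewrite zc eq_sym (negPf l1c) addn1.
Qed.

Lemma left_facing_in (D : dag) (c l1 l2 : D) x y p t k : in_star2 c l1 l2 ->
  0 < k <= x ->
  left_move (facing c l1 l2 x y p t) (facing c l1 l2 (x - k) y (p + k) t).
Proof.
move=> S kx; have [l1c l2c lP] := in_star2P S; have [St ll _] := S.
split; last by apply/ffunP => z; rewrite !ffunE; case: ifP => // _; case: ifP.
suff -> : blue (facing c l1 l2 (x - k) y (p + k) t) =
  [ffun z => if z == c then blue (facing c l1 l2 x y p t) c - k
             else if z == l1 then blue (facing c l1 l2 x y p t) l1 + k
             else blue (facing c l1 l2 x y p t) z].
  by apply: MoveIn; rewrite ?St ?l1c ?ffunE ?eqxx ?(negPf l1c).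
apply/ffunP => z; rewrite !ffunE !eqxx (negPf l1c) /=.
by case: eqVneq => //= zc; case: eqVneq.
Qed.

Lemma left_facing_out (D : dag) (c l1 l2 : D) x p t : in_star2 c l1 l2 -> 2 <= p ->
  left_move (facing c l1 l2 x 0 p t) (facing c l1 l2 x.+1 0 (p - 2) t).
Proof.
move=> S p2; have [l1c l2c lP] := in_star2P S; have [St ll _] := S.
split; last by apply/ffunP => z; rewrite !ffunE; case: ifP => // _; case: ifP.
suff -> : blue (facing c l1 l2 x.+1 0 (p - 2) t) =
  [ffun z => if z == l1 then blue (facing c l1 l2 x 0 p t) l1 - 2
             else if z == c then blue (facing c l1 l2 x 0 p t) c + 1
             else blue (facing c l1 l2 x 0 p t) z].
  by apply: MoveOut; rewrite ?St ?l1c ?ffunE ?eqxx ?(negPf l1c).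
apply/ffunP => z; rewrite !ffunE !eqxx (negPf l1c) /=.
by case: (eqVneq z c) => [->|zc]; [rewrite eq_sym (negPf l1c) addn1|case: eqVneq].
Qed.

Lemma right_facingP (D : dag) (c l1 l2 : D) x y p t q : in_star2 c l1 l2 ->
  right_move (facing c l1 l2 x y p t) q -> (y == 0) || (0 < p) ->
  (exists2 k, 0 < k <= y & q = facing c l1 l2 x (y - k) p (t + k)) \/
  [/\ x = 0, 2 <= t & q = facing c l1 l2 0 y.+1 p (t - 2)].
Proof.
move=> S m yp; have S' := in_star2C S.
have K (u v : position D) : swap_colors u = v -> u = swap_colors v.
  by move<-; case: u.
have m' : left_move (swap_colors (facing c l1 l2 x y p t)) (swap_colors q) by [].
rewrite swap_facing // in m'.
case: (left_facingP S' m' yp) => [[k ky]|[x0 t2]] /K ->.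
- by left; exists k => //; rewrite swap_facing.
- by right; split=> //; rewrite swap_facing.
Qed.

Lemma right_facing_out (D : dag) (c l1 l2 : D) y p t : in_star2 c l1 l2 -> 2 <= t ->
  right_move (facing c l1 l2 0 y p t) (facing c l1 l2 0 y.+1 p (t - 2)).
Proof.
move=> S /(left_facing_out y p (in_star2C S)).
by rewrite -(swap_facing _ _ _ _ S) -(swap_facing _ _ _ (t - 2) S).
Qed.

(** Right replies by occupying the empty centre; Left then has no move, so this right option is at
    most 0. *)
Lemma not_nat_le_facing (D : dag) (c l1 l2 : D) p t n : in_star2 c l1 l2 -> 2 <= t ->
  ~ game_le (game_nat n) (game_of (facing c l1 l2 0 0 p t)).
Proof.
move=> S t2 /game_leE [_ A].
have [j [jq _]] := right_move_ropt (right_facing_out 0 p S t2).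
apply: (A j); apply: game_le_trans jq _.
apply: (@game_le_trans (game_nat 0)); last exact/game_le_nat.
by apply: game_of_le_nat => q m; case: (left_facingP S m isT) => [[[|k]]|[]].
Qed.

Lemma facing_centre_value (D : dag) (c l1 l2 : D) x p t : in_star2 c l1 l2 ->
  0 < x -> 2 <= t ->
  has_value (facing c l1 l2 x 0 p t) (game_nat (3 * x + 2 * p - 5)).
Proof.
move=> S; have [s] := ubnP (3 * x + 2 * p); elim: s x p => // s IH x p xs x0 t2.
have xt : (x == 0) || (0 < t) by lia.
have noR q : ~ right_move (facing c l1 l2 x 0 p t) q.
  by move=> m; case: (right_facingP S m isT) => [[[|k]]|[]] //; lia.
split; last first.
- apply: game_nat_le_of_pos => // n0; have [p2|p2] := leqP 2 p.
    exists (facing c l1 l2 x.+1 0 (p - 2) t); first exact: left_facing_out.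
    have -> : (3 * x + 2 * p - 5).-1 = 3 * x.+1 + 2 * (p - 2) - 5 by lia.
    by case: (IH x.+1 (p - 2)) => //; lia.
  (* As [p <= 1], [n0] forces [x >= 2], so the centre stays occupied. *)
  exists (facing c l1 l2 (x - 1) 0 (p + 1) t).
    by apply: left_facing_in => //; lia.
  have -> : (3 * x + 2 * p - 5).-1 = 3 * (x - 1) + 2 * (p + 1) - 5 by lia.
  by case: (IH (x - 1) (p + 1)) => //; lia.
- apply/game_leE; split; last by case: (_ - 5) => [|?] [].
  move=> i le; have [q m [iq _]] := lopt_left_move i.
  have {i le iq} le := game_le_trans le iq.
  (* This refutes the moves that keep a blue pebble on the centre; the bound 5 makes the truncated
     value drop strictly. *)
  have small x' p' : 0 < x' -> 3 * x' + 2 * p' < 3 * x + 2 * p ->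
      5 < 3 * x + 2 * p -> q <> facing c l1 l2 x' 0 p' t.
    move=> x'0 lt n0 eq; have [|le' _] := IH x' p' _ x'0 t2; first by lia.
    have /game_le_nat : game_le (game_nat (3 * x + 2 * p - 5))
        (game_nat (3 * x' + 2 * p' - 5)).
      by apply: game_le_trans le'; rewrite -eq.
    by lia.
  case: (left_facingP S m xt) => [[k kx]|[_ p2]] eq.
  + have [kx'|kx'] := ltnP k x; first by apply: small eq; lia.
    (* Here [k = x]: Left vacates the centre. *)
    move: le; rewrite eq; have -> : x - k = 0 by lia.
    exact: not_nat_le_facing.
  + by apply: small eq; lia.
Qed.

Lemma leaf_total_facing (D : dag) (c l1 l2 : D) x y p t : in_star2 c l1 l2 ->
  leaf_total c (blue (facing c l1 l2 x y p t)) = p.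
Proof.
move=> S; have [l1c _ _] := in_star2P S.
rewrite /leaf_total (bigD1 l1 l1c) /= ffunE (negPf l1c) eqxx /= big1 ?addn0 //.
by move=> v /andP [vc v1]; rewrite ffunE (negPf vc) (negPf v1).
Qed.

(** A lone red pebble can never be merged onto the centre, so Right never moves and the bounds
    [star_le] and [star_ge] meet. *)
Lemma facing_single_value (D : dag) (c l1 l2 : D) a : in_star2 c l1 l2 -> 0 < a ->
  has_value (facing c l1 l2 0 0 a 1) (game_nat (2 * a - 2)).
Proof.
move=> S a0; have [l1c l2c lP] := in_star2P S; have [St ll _] := S.
have bc : blue (facing c l1 l2 0 0 a 1) c = 0 by rewrite ffunE eqxx.
have := leaf_total_facing 0 0 a 1 S.
move: (star_le (facing c l1 l2 0 0 a 1) St).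
move: (@star_ge D c l1 (facing c l1 l2 0 0 a 1) St).
rewrite bc => ge le lt; rewrite lt in ge le; split=> //.
apply: ge => //.
- by rewrite ffunE eqxx.
- by move=> v vc; rewrite ffunE (negPf vc); case: eqP.
- by move=> v vc; rewrite !ffunE (negPf vc); case: eqP.
- by rewrite ffunE (negPf l1c) eqxx.
- have [a2|a2] := leqP 2 a; last by constructor 3; lia.
  by constructor 2; exists l1; rewrite // ffunE (negPf l1c) eqxx.
Qed.

(* In [2 * a - 6] and [2 * b - 6] truncation matters only at 2, where the
   option is [0] and not [-2]. *)
Lemma facing_value (D : dag) (c l1 l2 : D) a b : in_star2 c l1 l2 -> 2 <= a -> 2 <= b ->
  has_value (facing c l1 l2 0 0 a b)
    (game_switch (game_nat (2 * a - 6)) (game_opp (game_nat (2 * b - 6)))).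
Proof.
move=> S a2 b2.
(* Occupying the centre leaves one pebble there and [n - 2] on the leaf; at [n = 2] both sides
   truncate to 0. *)
have formula n : 2 <= n -> 2 * n - 6 = 3 * 1 + 2 * (n - 2) - 5 by lia.
apply: (has_value_switch (left_facing_out 0 b S a2) _ _
                         (right_facing_out 0 a S b2)).
- by move=> q m; case: (left_facingP S m isT) => [[[|k]]|[]].
- by rewrite formula //; apply: facing_centre_value.
- by move=> q m; case: (right_facingP S m isT) => [[[|k]]|[]].
- apply: has_value_swap; rewrite swap_facing // formula //.
  exact/facing_centre_value/a2/isT/in_star2C.
Qed.

Lemma game_eq_switch2 (X X' Y Y' : game) : game_eq X X' -> game_eq Y Y' ->
  game_eq (game_switch X Y) (game_switch X' Y').
Proof. by move=> eX eY; apply: game_eq_switch => [_|_||] //; constructor. Qed.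

(** * Assembling the six values, with integer in place of truncated subtraction *)

Local Open Scope ring_scope.

Theorem theorem4 :
  (forall (D : dag) (c : D) (p : position D),
     in_star c ->
     (1 <= leaf_total c (blue p))%N ->
     (1 <= blue p c)%N ->
     (forall v : D, red p v = 0%N) ->
     has_value p
       (game_int (3 * (blue p c)%:Z + 2 * (leaf_total c (blue p))%:Z - 2)))
  /\
  (forall (D : dag) (c l1 l2 : D),
     in_star2 c l1 l2 ->
     let pos := star2_pos c l1 l2 in
     (has_value (pos (0, 0)%N (0, 1)%N (1, 0)%N) game0 /\
      has_value (pos (0, 0)%N (0, 2)%N (2, 0)%N) game_star)
     /\
     (forall a : nat, (2 <= a)%N ->
        has_value (pos (0, 0)%N (a, 0)%N (0, 1)%N) (game_int (2 * a%:Z - 2)))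
     /\
     (forall a : nat, (3 <= a)%N ->
        has_value (pos (0, 0)%N (a, 0)%N (0, 2)%N)
          (game_switch (game_int (2 * a%:Z - 6)) game0))
     /\
     (forall a b : nat, (3 <= a)%N -> (3 <= b)%N ->
        has_value (pos (0, 0)%N (a, 0)%N (0, b)%N)
          (game_switch (game_int (2 * a%:Z - 6)) (game_int (- 2 * b%:Z + 6))))
     /\
     (forall a b d : nat, (1 <= a)%N -> (1 <= b)%N -> (2 <= d)%N ->
        has_value (pos (a, 0)%N (b, 0)%N (0, d)%N)
          (game_int (3 * a%:Z + 2 * b%:Z - 5)))).
Proof.
split=> [D c p S bl bc r0|D c l1 l2 S pos].
  (* The potential is at least 5, so the two subtractions agree. *)
  have -> : 3 * (blue p c)%:Z + 2 * (leaf_total c (blue p))%:Z - 2 =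
      (3 * blue p c + 2 * leaf_total c (blue p) - 2)%N%:Z by lia.
  split; first exact: star_le.
  have [l lc] : exists l, l != c.
    apply/existsP; apply: contraTT bl => /existsPn no.
    rewrite -leqNgt leqn0 /leaf_total big1 // => v vc.
    by have := no v; rewrite vc.
  by apply: (star_ge S _ _ _ lc) => // [v _|]; [rewrite r0|constructor].
have eq_refl G : game_eq G G by split; apply: game_le_refl.
(* The right option supplied by [facing_value] at [b = 2] is a negated zero. *)
have eq00 : game_eq (game_opp (game_nat 0)) game0.
  exact: game_eq_sym (game_int_oppnat 0).
have S' := in_star2C S; split; [split|split; [|split; [|split]]].
(* With the leaves exchanged this is the case [a = 1], of value [2 * 1 - 2 = 0]. *)
- rewrite /pos star2_posC //; exact: (facing_single_value S' (isT : 0 < 1)%N).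
- rewrite /pos star2_posC //.
  apply: game_eq_trans (facing_value S' (isT : 2 <= 2)%N (isT : 2 <= 2)%N) _.
  exact: game_eq_switch2.
- move=> a a2; have -> : 2 * a%:Z - 2 = (2 * a - 2)%N%:Z by lia.
  by apply: (facing_single_value S); lia.
- move=> a a3; have -> : 2 * a%:Z - 6 = (2 * a - 6)%N%:Z by lia.
  have a2 : (2 <= a)%N by lia.
  apply: game_eq_trans (facing_value S a2 (isT : 2 <= 2)%N) _.
  exact: game_eq_switch2.
- move=> a b a3 b3; have -> : 2 * a%:Z - 6 = (2 * a - 6)%N%:Z by lia.
  have -> : - 2 * b%:Z + 6 = - (2 * b - 6)%N%:Z by lia.
  have [a2 b2] : (2 <= a)%N /\ (2 <= b)%N by lia.
  apply: game_eq_trans (facing_value S a2 b2) _.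
  by apply: game_eq_switch2 => //; apply/game_eq_sym/game_int_oppnat.
- move=> a b d a1 b1 d2.
  have -> : 3 * a%:Z + 2 * b%:Z - 5 = (3 * a + 2 * b - 5)%N%:Z by lia.
  exact: (facing_centre_value b S a1 d2).
Qed.
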